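(* Let $\Gamma=(T,\sigma)$ be a signed tree on $n\geq 2$ vertices $1,2,\ldots,n$ and $n-1$ edges $e_1,\ldots,e_{n-1}$, and let $N$ be an incidence matrix of $\Gamma$. Then the Moore–Penrose inverse $N^\dagger=[n^\dagger_{i,j}]$ (an $(n-1)\times n$ matrix, rows indexed by edges, columns by vertices) is given by \[ n^\dagger_{i,j}=\frac{\mathrm{sgn}(P_{e_i-j})\,w(e_i)}{n}\begin{cases}|T_h(e_i)| & \text{if } j\in T_t(e_i),\\ -\sigma(e_i)\,|T_t(e_i)| & \text{if } j\in T_h(e_i).\end{cases} \]
   Context: A signed graph $\Gamma=(G,\sigma)$ consists of a simple graph $G=(V,E)$, $V=\{1,\ldots,n\}$, $E=\{e_1,\ldots,e_m\}$, and $\sigma:E\to\{-1,1\}$; $e$ is positive if $\sigma(e)=1$ and negative if $\sigma(e)=-1$. An incidence matrix of $\Gamma$ is an $n\times m$ matrix $N=[n_{k\ell}]$ (rows = vertices, columns = edges) such that for each edge $e_\ell=\{i,j\}$ column $\ell$ has exactly two nonzero entries $n_{i\ell},n_{j\ell}\in\{1,-1\}$, with $n_{i\ell}=n_{j\ell}$ if $e_\ell$ is negative and $n_{i\ell}=-n_{j\ell}$ if $e_\ell$ is positive. Head and tail of an edge: if $e_\ell=\{l,m\}$ is positive with $n_{l\ell}=1$, $n_{m\ell}=-1$, then $e_\ell$ is directed from its tail $l$ to its head $m$; if $e_\ell=\{l,m\}$ is negative with $l<m$, its tail is $l$ and its head is $m$. $w(e_\ell)=-1$ if $e_\ell$ is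 negative and both nonzero entries of column $\ell$ equal $-1$, and $w(e_\ell)=1$ otherwise. For an edge $e_i$ of the tree $T$, $T_h(e_i)$ (resp. $T_t(e_i)$) is the connected component of $T\setminus e_i$ containing the head (resp. tail) of $e_i$, and $|\cdot|$ denotes its number of vertices. For a vertex $j$, $P_{e_i-j}$ is the shortest path between $j$ and the edge $e_i$ not containing $e_i$ (i.e. the path in $T$ from the endpoint of $e_i$ nearest to $j$ to $j$), and $\mathrm{sgn}(P_{e_i-j})$ is the product of $\sigma$ over its edges (equal to $1$ for the empty path). *)

(* Defs.v *)
From HB Require Import structures.
From mathcomp Require Import all_boot all_order all_algebra.
Set Implicit Arguments.
Unset Strict Implicit.
Unset Printing Implicit Defensive.
Import Order.TTheory GRing.Theory Num.Theory.
Local Open Scope ring_scope.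

Definition penrose (R : realFieldType) (m n : nat)
    (A : 'M[R]_(m, n)) (X : 'M[R]_(n, m)) : bool :=
  [&& A *m X *m A == A, X *m A *m X == X,
      (A *m X)^T == A *m X & (X *m A)^T == X *m A].

Lemma mulmx_trmx_eq0 (R : realFieldType) (m n : nat) (A : 'M[R]_(m, n)) :
  A *m A^T = 0 -> A = 0.
Proof.
move=> AA0; apply/matrixP=> i j; rewrite mxE.
have /eqP := congr1 (fun M : 'M_m => M i i) AA0.
rewrite !mxE psumr_eq0 => [|k _]; last by rewrite mxE -expr2 sqr_ge0.
by move/allP/(_ j (mem_index_enum _)); rewrite mxE mulf_eq0 orbb => /eqP.
Qed.

Lemma gram_unitmx (R : realFieldType) (r n : nat) (A : 'M[R]_(r, n)) :
  row_free A -> A *m A^T \in unitmx.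
Proof.
move=> fA; rewrite -row_free_unit -kermx_eq0; apply/eqP/row_matrixP=> i.
rewrite row0; set v := row i _.
have vAA : v *m (A *m A^T) = 0 by apply/sub_kermxP; apply: row_sub.
have vA : v *m A = 0.
  by apply: mulmx_trmx_eq0; rewrite trmx_mul !mulmxA -(mulmxA v) vAA mul0mx.
by apply: (row_free_inj fA); rewrite vA mul0mx.
Qed.

Lemma penrose_exists (R : realFieldType) (m n : nat) (A : 'M[R]_(m, n)) :
  exists X, penrose A X.
Proof.
have [r [C [B [AE fB fC]]]] : exists r (C : 'M[R]_(m, r)) (B : 'M[R]_(r, n)),
    [/\ A = C *m B, row_free B & row_free C^T].
  exists (\rank A), (col_base A), (row_base A).
  split; [by rewrite mulmx_base | exact: row_base_free |].
  by rewrite /row_free mxrank_tr; exact: col_base_full.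
have UB : B *m B^T \in unitmx by exact: gram_unitmx.
have UC : C^T *m C \in unitmx by rewrite -{2}(trmxK C); exact: gram_unitmx.
pose G := invmx (B *m B^T); pose H := invmx (C^T *m C).
have GT : G^T = G by rewrite trmx_inv trmx_mul trmxK.
have HT : H^T = H by rewrite trmx_inv trmx_mul trmxK.
pose X := B^T *m G *m (H *m C^T).
have AX : A *m X = C *m H *m C^T.
  by rewrite AE /X !mulmxA -(mulmxA C B) -(mulmxA C (B *m _)) mulmxV // mulmx1.
have XA : X *m A = B^T *m G *m B.
  rewrite AE /X -!mulmxA (mulmxA C^T) (mulmxA H) mulVmx // mul1mx.
  by rewrite !mulmxA.
exists X; apply/and4P; split; apply/eqP.
- rewrite AX {1}AE -!mulmxA (mulmxA C^T) (mulmxA H) mulVmx // mul1mx.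
  by rewrite -AE.
- rewrite XA /X !mulmxA -(mulmxA (B^T *m G) B) -(mulmxA (B^T *m G) (B *m _)).
  by rewrite mulmxV // mulmx1.
- by rewrite AX !trmx_mul trmxK HT mulmxA.
- by rewrite XA !trmx_mul trmxK GT mulmxA.
Qed.

Lemma penrose_unique (R : realFieldType) (m n : nat) (A : 'M[R]_(m, n))
    (X Y : 'M[R]_(n, m)) : penrose A X -> penrose A Y -> X = Y.
Proof.
case/and4P=> /eqP X1 /eqP X2 /eqP X3 /eqP X4.
case/and4P=> /eqP Y1 /eqP Y2 /eqP Y3 /eqP Y4.
have E1 : A *m X = A *m Y.
  rewrite -{1}Y1 -(mulmxA _ A X) -Y3 -X3 -trmx_mul.
  by rewrite mulmxA X1 Y3.
have E2 : X *m A = Y *m A.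
  rewrite -{1}Y1 -(mulmxA A Y A) mulmxA -Y4 -X4 -trmx_mul.
  by rewrite -(mulmxA Y A) (mulmxA A X) X1 Y4.
by rewrite -X2 E2 -(mulmxA Y A X) E1 mulmxA Y2.
Qed.

(* The unique matrix satisfying the four Penrose equations. *)
Definition mpinv (R : realFieldType) (m n : nat) (A : 'M[R]_(m, n)) :
  'M[R]_(n, m) := xchoose (penrose_exists A).

Lemma mpinvP (R : realFieldType) (m n : nat) (A : 'M[R]_(m, n)) :
  penrose A (mpinv A).
Proof. exact: xchooseP. Qed.

(* Vertices are 0, ..., n-1 with their usual order; the edges e_1, ..., e_m
   are enumerated without repetition by [edge]. *)
Record signed_graph (n m : nat) := SignedGraph {
  edge : 'I_m -> {set 'I_n};
  sigma : 'I_m -> int;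
  card_edge : forall l, #|edge l| = 2%N;
  edge_inj : injective edge;
  sigmaP : forall l, sigma l = 1 \/ sigma l = -1 }.

Section SignedGraph.
Variables (n m : nat) (G : signed_graph n m).

Definition adj : rel 'I_n := [rel x y | [exists l, edge G l == [set x; y]]].

Definition adj_del (e : 'I_m) : rel 'I_n :=
  [rel x y | [exists l, (l != e) && (edge G l == [set x; y])]].

Definition is_tree : Prop :=
  (forall x y, connect adj x y) /\
  (forall c : seq 'I_n, (2 < size c)%N -> ~ ucycle adj c).

(* Product of the signs of the edges of the walk x :: p; the inner product has
   exactly one factor when x and y are adjacent. *)
Fixpoint walk_sgn (x : 'I_n) (p : seq 'I_n) : int :=
  if p is y :: q then (\prod_(l | edge G l == [set x; y]) sigma G l)
                      * walk_sgn y q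
  else 1.

Definition edge_vertex_path (e : 'I_m) (j x : 'I_n) (p : seq 'I_n) : bool :=
  [&& x \in edge G e, path (adj_del e) x p, uniq (x :: p) & last x p == j].

(* x :: p is P_{e-j}; it starts at an endpoint x of e and ends at j. *)
Definition shortest_edge_vertex_path (e : 'I_m) (j x : 'I_n) (p : seq 'I_n)
    : Prop :=
  edge_vertex_path e j x p /\
  forall y q, edge_vertex_path e j y q -> (size p <= size q)%N.

Section Incidence.
Variables (R : realFieldType) (N : 'M[R]_(n, m)).

Definition is_incidence : Prop := forall l,
  [/\ forall k, k \notin edge G l -> N k l = 0,
      forall k, k \in edge G l -> N k l = 1 \/ N k l = -1
    & forall i j, i \in edge G l -> j \in edge G l -> i != j ->
        (sigma G l = -1 -> N i l = N j l) /\
        (sigma G l = 1 -> N i l = - N j l)].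

Definition is_tail (l : 'I_m) (x : 'I_n) : bool :=
  (x \in edge G l) &&
  (if sigma G l == 1 then N x l == 1
   else [forall y in edge G l, (x <= y)%N]).

Definition is_head (l : 'I_m) (x : 'I_n) : bool :=
  (x \in edge G l) &&
  (if sigma G l == 1 then N x l == -1
   else [forall y in edge G l, (y <= x)%N]).

(* Vertex sets of the components of T \ e containing the tail, resp. the head,
   of e. *)
Definition Tt (e : 'I_m) : {set 'I_n} :=
  [set y | [exists x, is_tail e x && connect (adj_del e) x y]].

Definition Th (e : 'I_m) : {set 'I_n} :=
  [set y | [exists x, is_head e x && connect (adj_del e) x y]].

Definition edge_weight (l : 'I_m) : int :=
  if (sigma G l == -1) && [forall k in edge G l, N k l == -1] then -1 else 1.

End Incidence.

(* The remaining facts show that head, tail, Tt, Th and P_{e-j} are well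
   defined for a signed tree. *)

Lemma adj_sym : symmetric adj.
Proof. by move=> x y; apply: eq_existsb => l; rewrite setUC. Qed.

Lemma adj_del_sym e : symmetric (adj_del e).
Proof. by move=> x y; apply: eq_existsb => l; rewrite setUC. Qed.

Lemma tail_head_edge (R : realFieldType) (N : 'M[R]_(n, m)) (e : 'I_m) :
  is_incidence N ->
  exists t h, [/\ t != h, edge G e = [set t; h],
    is_tail N e =1 pred1 t & is_head N e =1 pred1 h].
Proof.
move=> /(_ e) [_ N1 N2].
have /eqP/cards2P [a [b [ab eE]]] := card_edge G e.
wlog H : a b ab eE / if sigma G e == 1 then N a e = 1 else (a < b)%N.
  move=> W; case: (boolP (if sigma G e == 1 then N a e == 1 else (a < b)%N)) => H.
    by apply: (W a b ab eE); case: ifP H => // _ /eqP.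
  have ba : b != a by rewrite eq_sym.
  apply: (W b a ba); first by rewrite setUC.
  have aE : a \in edge G e by rewrite eE !inE eqxx.
  have bE : b \in edge G e by rewrite eE !inE eqxx orbT.
  case: ifP H => [/eqP s1|_] H.
    have [_ /(_ s1) ->] := N2 b a bE aE ba.
    by case: (N1 a aE) H => ->; rewrite ?eqxx ?opprK.
  by rewrite -leqNgt in H; rewrite ltn_neqAle H andbT eq_sym.
have aE : a \in edge G e by rewrite eE !inE eqxx.
have bE : b \in edge G e by rewrite eE !inE eqxx orbT.
have m11 : (1 == -1 :> R) = false.
  by rewrite -subr_eq0 opprK -mulr2n pnatr_eq0.
exists a, b; split=> // x; rewrite /is_tail /is_head /= eE !inE.
- case: eqP H => [s1|_] H.
    have [_ /(_ s1)] := N2 a b aE bE ab; rewrite H => /eqP.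
    rewrite eq_sym eqr_oppLR => /eqP Nb.
    case: (x =P a) => [->|_] /=; first by rewrite H eqxx.
    by case: (x =P b) => //= ->; rewrite Nb eq_sym m11.
  apply/andP/eqP=> [[/orP[/eqP//|/eqP->]] /forall_inP/(_ a)|->].
    by rewrite !inE eqxx leqNgt H => /(_ isT).
  split; rewrite ?eqxx //; apply/forall_inP=> y; rewrite !inE.
  by case/orP=> /eqP-> //; exact: ltnW.
case: eqP H => [s1|_] H.
  have [_ /(_ s1)] := N2 a b aE bE ab; rewrite H => /eqP.
  rewrite eq_sym eqr_oppLR => /eqP Nb.
  case: (x =P b) => [->|_] /=; first by rewrite Nb eqxx orbT.
  by rewrite orbF; case: (x =P a) => //= ->; rewrite H m11.
apply/andP/eqP=> [[/orP[/eqP->|/eqP//]] /forall_inP/(_ b)|->].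
  by rewrite !inE eqxx orbT leqNgt H => /(_ isT).
split; rewrite ?eqxx ?orbT //; apply/forall_inP=> y; rewrite !inE.
by case/orP=> /eqP-> //; exact: ltnW.
Qed.

Lemma connect_edge_end e j :
  (forall x y, connect adj x y) ->
  exists2 x, x \in edge G e & connect (adj_del e) x j.
Proof.
move=> cG.
have /card_gt0P [x0 x0e] : (0 < #|edge G e|)%N by rewrite card_edge.
have [p Pp lp] := connectP (cG x0 j).
have [] : connect (adj_del e) x0 j \/
    exists2 x, x \in edge G e & connect (adj_del e) x j; [|by exists x0|by []].
elim: p x0 {x0e} Pp lp => [|y p IH] x /= Pp lp; first by left; rewrite lp.
case/andP: Pp => /existsP [l /eqP lE] Pp.
case: (IH y Pp lp) => [yj|]; last by right.
have [le|le] := eqVneq l e.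
  by right; exists y => //; rewrite -le lE !inE eqxx orbT.
left; apply: connect_trans yj; apply: connect1.
by apply/existsP; exists l; rewrite le lE eqxx.
Qed.

Lemma shortest_edge_vertex_path_exists e j :
  is_tree -> exists x p, shortest_edge_vertex_path e j x p.
Proof.
case=> cG _; have [x xe /connectP [q0 Pq0]] := connect_edge_end e j cG.
have [q Pq Uq _] := shortenP Pq0 => lq {q0 Pq0}.
pose P k := [exists x, exists t : k.-tuple 'I_n, edge_vertex_path e j x t].
have exP : exists k, P k.
  exists (size q); apply/existsP; exists x; apply/existsP; exists (in_tuple q).
  by apply/and4P; split=> //; rewrite lq.
case: (ex_minnP exP) => k /existsP [y /existsP [t yt]] kmin.
exists y, t; split=> // z r zr; rewrite size_tuple; apply: kmin.
by apply/existsP; exists z; apply/existsP; exists (in_tuple r).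
Qed.

Lemma Th_setC_Tt (R : realFieldType) (N : 'M[R]_(n, m)) (e : 'I_m) :
  is_tree -> is_incidence N -> Th N e = ~: Tt N e.
Proof.
case=> cG acG /tail_head_edge -/(_ e) [t [h [th eE tE hE]]].
have memT y : (y \in Tt N e) = connect (adj_del e) t y.
  rewrite inE; apply/existsP/idP => [[x]|ty].
    by rewrite tE => /andP [/eqP->].
  by exists t; rewrite tE /= eqxx.
have memH y : (y \in Th N e) = connect (adj_del e) h y.
  rewrite inE; apply/existsP/idP => [[x]|hy].
    by rewrite hE => /andP [/eqP->].
  by exists h; rewrite hE /= eqxx.
apply/setP=> j; rewrite memH in_setC memT; apply/idP/idP; last first.
  have [x] := connect_edge_end e j cG; rewrite eE !inE.
  by case/orP=> /eqP-> -> .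
move=> hj; apply/negP=> tj.
have /connectP [p0 Pp0] : connect (adj_del e) t h.
  apply: connect_trans tj _.
  by rewrite (sym_connect_sym (@adj_del_sym e)).
have [p Pp Up _] := shortenP Pp0 => lp {p0 Pp0}.
have sub : subrel (adj_del e) adj.
  by move=> x y /existsP [l /andP [_ lE]]; apply/existsP; exists l.
apply: (acG (t :: p)).
  case: p Pp lp {Up} => [_ /eqP|y [|z p]] //=; first by rewrite eq_sym (negPf th).
  rewrite andbT => /existsP [l /andP [le /eqP lE]] hy.
  by case/eqP: le; apply: (@edge_inj _ _ G); rewrite lE eE hy.
rewrite /ucycle Up andbT /= rcons_path (sub_path sub Pp) -lp /=.
by apply/existsP; exists e; rewrite eE setUC.
Qed.

End SignedGraph.

(* Main.v *)
Require Import Defs.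
From mathcomp Require Import all_boot all_order all_algebra.
From mathcomp Require Import ring.
Set Implicit Arguments.
Unset Strict Implicit.
Unset Printing Implicit Defensive.
Import Order.TTheory GRing.Theory Num.Theory.
Local Open Scope ring_scope.

(** An incidence matrix [N] of a tree has more rows than columns, hence a
    nonzero left kernel vector [s]. The equation [s N = 0] says
    [s b = sigma (a b) * s a] along every edge, so by connectivity [s] may be
    scaled to have entries [+1] and [-1], it spans the left kernel, and the sign
    of a walk is the product of the values of [s] at its ends. Writing [t] for
    the tail of [e_i], the claimed entries become
      [X i j = N t i * s t * s j * ([j \in Tt i] - #|Tt i| / n)].
    The constant [#|Tt i| / n] contributes nothing to [X N], and an edge other
    than [e_i] has both or no ends in [Tt i]; hence [X N = 1]. Moreover
    [X s = 0], and these two facts identify [X] as the Moore-Penrose inverse. *)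

(** Since [A *m mpinv A *m A = A], the rows of [1 - A *m mpinv A] lie in the left kernel of [A], so
    [X^T] kills them. As [A *m mpinv A] is symmetric, transposing gives
    [X = X *m A *m mpinv A = mpinv A]. *)
Lemma mpinv_left_inverse (R : realFieldType) (m n : nat) (A : 'M[R]_(m, n))
    (X : 'M[R]_(n, m)) :
  X *m A = 1%:M -> (forall q : 'rV_m, q *m A = 0 -> q *m X^T = 0) ->
  mpinv A = X.
Proof.
move=> XA kerX; have /and4P[/eqP A1 _ /eqP A3 _] := mpinvP A.
have QX : (1%:M - A *m mpinv A) *m X^T = 0.
  apply/row_matrixP=> k; rewrite row_mul row0; apply: kerX.
  by rewrite -row_mul mulmxBl mul1mx A1 subrr row0.
have /eqP : X *m (1%:M - A *m mpinv A) = 0.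
  apply: trmx_inj; rewrite trmx_mul trmx0 -QX; congr (_ *m _).
  by rewrite linearB /= A3 trmx1.
by rewrite mulmxBr mulmx1 mulmxA XA mul1mx subr_eq0 => /eqP.
Qed.

(** * Left kernel of an incidence matrix and signs of walks *)

Section Incidence.
Variables (R : realFieldType) (n m : nat) (G : signed_graph n m).
Variables (N : 'M[R]_(n, m)) (hN : is_incidence G N).
Implicit Types (q s : 'rV[R]_n) (l e : 'I_m).

Lemma edge_neq l a b : edge G l = [set a; b] -> a != b.
Proof. by move=> lE; have := card_edge G l; rewrite lE cards2; case: eqP. Qed.

Lemma mulmx_incidence q l a b : edge G l = [set a; b] ->
  (q *m N) 0 l = q 0 a * N a l + q 0 b * N b l.
Proof.
move=> lE; have ab := edge_neq lE; have [N0 _ _] := hN l.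
rewrite mxE (bigD1 a) //= (bigD1 b) 1?eq_sym //= big1 ?addr0 // => k.
by case/andP=> ka kb; rewrite N0 ?mulr0 // lE !inE negb_or ka.
Qed.

Lemma sqr_incidence l a : a \in edge G l -> N a l * N a l = 1.
Proof. by move=> ae; have [_ /(_ a ae)[]-> _] := hN l; rewrite ?mulrNN mulr1. Qed.

Lemma incidence_other_end l a b : edge G l = [set a; b] ->
  N a l = - (sigma G l)%:~R * N b l.
Proof.
move=> lE; have ab := edge_neq lE.
have [_ _ /(_ a b)] := hN l; rewrite lE !inE !eqxx orbT.
case/(_ isT isT ab) => Nn Np.
by case: (sigmaP G l) => sl; rewrite sl ?(Np sl) ?(Nn sl) ?mulN1r ?opprK ?mul1r.
Qed.

Lemma sqr_sigma l : (sigma G l)%:~R * (sigma G l)%:~R = 1 :> R.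
Proof. by case: (sigmaP G l) => ->; rewrite ?mulrNN mulr1. Qed.

(** Entry [l] of [q *m N = 0] reads [N b l * (q b - sigma l * q a) = 0], and [N b l] is nonzero. *)
Lemma left_kernel_edge q l a b : q *m N = 0 -> edge G l = [set a; b] ->
  q 0 b = (sigma G l)%:~R * q 0 a.
Proof.
move=> qN lE; have /esym := mulmx_incidence q lE.
rewrite qN mxE (incidence_other_end lE) mulrA -mulrDl => /eqP.
rewrite mulf_eq0 => /orP[|/eqP Nb0].
  by rewrite mulrN addrC subr_eq0 mulrC => /eqP.
have : b \in edge G l by rewrite lE !inE eqxx orbT.
by move/sqr_incidence/eqP; rewrite Nb0 mul0r eq_sym oner_eq0.
Qed.

(** Crossing an edge multiplies both vectors by the same sign, so proportionality propagates along
    paths. *)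
Lemma left_kernel_prop q s : (forall x y, connect (adj G) x y) ->
  q *m N = 0 -> s *m N = 0 -> forall x y, q 0 x * s 0 y = q 0 y * s 0 x.
Proof.
move=> cG qN sN x y; have /connectP[p] := cG x y.
elim/last_ind: p y => [|p z IH] y /=; first by move=> _ ->.
rewrite rcons_path last_rcons => /andP[Pp /existsP[l /eqP lE]] ->.
rewrite (left_kernel_edge qN lE) (left_kernel_edge sN lE).
by rewrite mulrCA (IH _ Pp) // mulrA.
Qed.

(** With fewer columns than rows the left kernel is nonzero. Entries at adjacent vertices differ by
    a sign, so all squares agree, none vanishes, and dividing by the entry at [r] makes every square
    1. *)
Lemma left_kernel_sign (r : 'I_n) : (m < n)%N ->
  (forall x y, connect (adj G) x y) ->
  exists2 s : 'rV[R]_n, s *m N = 0 & forall x, s 0 x * s 0 x = 1.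
Proof.
move=> mn cG.
have /rowV0Pn[q qK q0] : kermx N != 0.
  rewrite kermx_eq0 /row_free neq_ltn (leq_ltn_trans _ mn) //.
  exact: rank_leq_col.
have qN : q *m N = 0 by apply/sub_kermxP.
have qq x y : q 0 x * q 0 x = q 0 y * q 0 y.
  have /connectP[p] := cG x y.
  elim: p x => [|z p IH] x /=; first by move=> _ ->.
  case/andP=> /existsP[l /eqP lE] Pp lp; rewrite -(IH z) //.
  by rewrite (left_kernel_edge qN lE) mulrACA sqr_sigma mul1r.
have qr : q 0 r != 0.
  apply: contraNneq q0 => qr; apply/eqP/rowP=> k; rewrite mxE.
  by have /eqP := qq k r; rewrite qr mul0r mulf_eq0 orbb => /eqP.
exists ((q 0 r)^-1 *: q); first by rewrite -scalemxAl qN scaler0.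
by move=> k; rewrite !mxE mulrACA (qq k r) -invfM mulVf // mulf_neq0.
Qed.

Lemma walk_sgn_left_kernel q : q *m N = 0 -> forall x p, path (adj G) x p ->
  q 0 (last x p) = (walk_sgn G x p)%:~R * q 0 x.
Proof.
move=> qN x p; elim: p x => [|y p IH] x /=; first by rewrite mul1r.
case/andP=> /existsP[l /eqP lE] /IH->.
(* Injectivity of [edge] leaves [l] as the only factor of the product for this step of the walk. *)
rewrite (left_kernel_edge qN lE) (big_pred1 l) => [|k].
  by rewrite intrM mulrA; congr (_ * _); rewrite mulrC.
by apply/eqP/eqP=> [kE|->//]; apply: (@edge_inj _ _ G); rewrite kE lE.
Qed.

(** The tail of a positive edge carries 1 by orientation; the ends of a negative edge share their
    entry, which is then the weight. *)
Lemma incidence_tail e t : is_tail G N e t -> N t e = (edge_weight G N e)%:~R.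
Proof.
have [N0 N1 N2] := hN e; case/andP=> te; rewrite /edge_weight.
case: (sigmaP G e) => se; rewrite se /=; first by move/eqP.
move=> _; case: forall_inP => [H|H]; first by rewrite (eqP (H t te)).
case: (N1 t te) => // Nt; case: H => k ke; rewrite -Nt; apply/eqP.
have [->//|kt] := eqVneq k t.
by have [/(_ se)] := N2 k t ke te kt.
Qed.

Lemma adj_del_sub e : subrel (adj_del G e) (adj G).
Proof. by move=> a b /existsP[l /andP[_ lE]]; apply/existsP; exists l. Qed.

Lemma mem_Tt e t : is_tail G N e =1 pred1 t ->
  Tt G N e =i connect (adj_del G e) t.
Proof.
move=> tE y; rewrite inE; apply/existsP/idP => [[a]|ty].
  by rewrite tE => /andP[/eqP->].
by exists t; rewrite tE /= eqxx.
Qed.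

Lemma mem_Tt_edge e l a b : l != e -> edge G l = [set a; b] ->
  (a \in Tt G N e) = (b \in Tt G N e).
Proof.
move=> le lE; rewrite !inE; apply: eq_existsb => t; congr (_ && _).
apply: same_connect1r; first exact: sym_connect_sym (@adj_del_sym _ _ G e).
by apply/existsP; exists l; rewrite le lE eqxx.
Qed.

End Incidence.

(** * The candidate inverse of a tree *)

Section Tree.
Variables (R : realFieldType) (n m : nat) (G : signed_graph n m).
Variables (N : 'M[R]_(n, m)) (hN : is_incidence G N) (hG : is_tree G).
Variables (s : 'rV[R]_n) (sN : s *m N = 0) (ss : forall x, s 0 x * s 0 x = 1).
Implicit Types (l e : 'I_m).

Lemma tail_in_Tt e t : is_tail G N e t -> t \in Tt G N e.
Proof. by move=> te; rewrite inE; apply/existsP; exists t; rewrite te connect0. Qed.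

Lemma head_notin_Tt e h : is_head G N e h -> h \notin Tt G N e.
Proof.
move=> he; rewrite -in_setC -(Th_setC_Tt e hG hN) inE.
by apply/existsP; exists h; rewrite he connect0.
Qed.

(** The sum is entry [l] of [q *m N], where [q] is [s] restricted to the tail component. For [l = e]
    only the tail contributes; otherwise both ends do, giving an entry of [s *m N = 0], or
    neither. *)
Lemma sum_Tt e t l : is_tail G N e t ->
  \sum_(j in Tt G N e) s 0 j * N j l = s 0 t * N t e *+ (l == e).
Proof.
move=> te; pose q : 'rV[R]_n := \row_j (s 0 j *+ (j \in Tt G N e)).
have -> : \sum_(j in Tt G N e) s 0 j * N j l = (q *m N) 0 l.
  rewrite mxE big_mkcond; apply: eq_bigr => j _; rewrite mxE.
  by case: ifP; rewrite ?mul0r.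
have [-> | le] := eqVneq l e.
  have [t' [h [th eE tE hE]]] := tail_head_edge e hN.
  have tt' : t = t' by move: te; rewrite tE => /eqP.
  rewrite (mulmx_incidence hN q eE) !mxE -tt' tail_in_Tt //.
  by rewrite (negPf (@head_notin_Tt e h _)) ?hE /= ?eqxx // mul0r addr0.
have [a [b [ab lE _ _]]] := tail_head_edge l hN.
rewrite (mulmx_incidence hN q lE) !mxE (mem_Tt_edge N le lE).
case: (b \in _); last by rewrite !mul0r addr0.
by rewrite -(mulmx_incidence hN s lE) sN mxE.
Qed.

(** This is the sign [s t * N t e] at the tail [t], written without naming [t]. *)
Let c e := \sum_(j in Tt G N e) s 0 j * N j e.

Lemma tail_coefE e t : is_tail G N e t -> c e = s 0 t * N t e.
Proof. by move=> te; rewrite /c (sum_Tt _ te) eqxx. Qed.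

(** Subtracting the mean of the indicator makes every row orthogonal to [s]. *)
Definition tree_pinv : 'M[R]_(m, n) :=
  \matrix_(e, j) (c e * (s 0 j * ((j \in Tt G N e)%:R - #|Tt G N e|%:R / n%:R))).

Lemma tree_pinv_mul : tree_pinv *m N = 1%:M.
Proof.
apply/matrixP=> e l; have [t [h [th eE tE hE]]] := tail_head_edge e hN.
have te : is_tail G N e t by rewrite tE /= eqxx.
pose k : R := #|Tt G N e|%:R / n%:R; rewrite mxE [RHS]mxE.
have -> : \sum_j tree_pinv e j * N j l
    = c e * (\sum_(j in Tt G N e) s 0 j * N j l - k * (s *m N) 0 l).
  rewrite mxE [X in X - _]big_mkcond mulr_sumr -sumrB mulr_sumr.
  by apply: eq_bigr => j _; rewrite mxE -/k; case: ifP => _ /=; ring.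
rewrite sN mxE mulr0 subr0 (sum_Tt _ te) (tail_coefE te) mulrnAr mulrACA ss.
by rewrite mul1r (sqr_incidence hN) ?eE ?inE ?eqxx // eq_sym.
Qed.

Lemma tree_pinv_kernel : (0 < n)%N -> s *m tree_pinv^T = 0.
Proof.
move=> n0; apply/rowP=> e; rewrite !mxE.
transitivity (c e * \sum_j ((j \in Tt G N e)%:R - #|Tt G N e|%:R / n%:R)).
  rewrite mulr_sumr; apply: eq_bigr => j _.
  by rewrite !mxE mulrCA (mulrA (s 0 j)) ss mul1r.
rewrite sumrB -natr_sum -big_mkcond sum1_card sumr_const card_ord.
by rewrite -[_ / _ *+ n]mulr_natr divfK ?subrr ?mulr0 // pnatr_eq0 -lt0n.
Qed.

Lemma mpinv_tree : (0 < n)%N -> mpinv N = tree_pinv.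
Proof.
move=> n0; apply: mpinv_left_inverse tree_pinv_mul _ => q qN.
pose r := Ordinal n0.
(* The scalar comes from [q r * s k = q k * s r] and [s r * s r = 1]. *)
suff -> : q = (q 0 r * s 0 r) *: s.
  by rewrite -scalemxAl tree_pinv_kernel // scaler0.
apply/rowP=> k; rewrite mxE mulrAC.
by rewrite (left_kernel_prop hN hG.1 qN sN r k) -mulrA ss mulr1.
Qed.

Lemma walk_sgnE e x p : path (adj_del G e) x p ->
  (walk_sgn G x p)%:~R = s 0 x * s 0 (last x p).
Proof.
move/(sub_path (@adj_del_sub _ _ G e))/(walk_sgn_left_kernel hN sN)=> ->.
by rewrite mulrCA ss mulr1.
Qed.

End Tree.

Theorem theorem3p2 (R : realFieldType) (n : nat) (hn : (2 <= n)%N)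
    (G : signed_graph n n.-1) (hG : is_tree G)
    (N : 'M[R]_(n, n.-1)) (hN : is_incidence G N)
    (i : 'I_n.-1) (j : 'I_n)
    (x : 'I_n) (p : seq 'I_n) (hp : shortest_edge_vertex_path G i j x p) :
  (j \in Tt G N i ->
     mpinv N i j
     = (walk_sgn G x p)%:~R * (edge_weight G N i)%:~R / n%:R
       * #|Th G N i|%:R) /\
  (j \in Th G N i ->
     mpinv N i j
     = (walk_sgn G x p)%:~R * (edge_weight G N i)%:~R / n%:R
       * (- (sigma G i)%:~R * #|Tt G N i|%:R)).
Proof.
have n0 : (0 < n)%N by apply: leq_trans hn.
have [s sN ss] : exists2 s : 'rV[R]_n, s *m N = 0 & forall x, s 0 x * s 0 x = 1.
  by apply: (left_kernel_sign hN (Ordinal n0) _ hG.1); rewrite ltn_predL.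
have nR : n%:R != 0 :> R by rewrite pnatr_eq0 -lt0n.
have [t [h [th eE tE hE]]] := tail_head_edge i hN.
have ti : is_tail G N i t by rewrite tE /= eqxx.
have hi : is_head G N i h by rewrite hE /= eqxx.
have [/and4P[xi Pp _ /eqP lp] _] := hp.
(* The path avoids [e_i], so its two ends lie in the same component; hence [x] is the tail or the
   head according to the side of [j]. *)
have xj : (x \in Tt G N i) = (j \in Tt G N i).
  rewrite !(mem_Tt tE) -!topredE /=; apply: same_connect_r.
    exact: sym_connect_sym (@adj_del_sym _ _ G i).
  by apply/connectP; exists p.
have xth : x = if j \in Tt G N i then t else h.
  move: xi xj; rewrite eE in_set2 => /orP[]/eqP->.
    by rewrite (tail_in_Tt ti) => <-.
  by rewrite (negPf (head_notin_Tt hN hG hi)) => <-.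
have ThE := Th_setC_Tt i hG hN.
have cardT : #|Th G N i|%:R = n%:R - #|Tt G N i|%:R :> R.
  by rewrite ThE cardsCs setCK card_ord natrB // -[leqRHS](card_ord n) max_card.
rewrite (walk_sgnE hN sN ss Pp) lp (mpinv_tree hN hG sN ss n0) mxE.
rewrite (tail_coefE hN hG sN ti) -(incidence_tail hN ti) xth.
(* On the tail side, [1 - #|Tt| / n = #|Th| / n]. *)
rewrite cardT ThE in_setC; split=> [->|/negPf->] /=; first by field.
(* On the head side the path sign is [s h * s j] with [s h = sigma i * s t]; this extra sign cancels
   the factor [sigma i] of the formula. *)
by rewrite (left_kernel_edge hN sN eE); case: (sigmaP G i) => ->; field.
Qed.
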